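(* Let $1\le k\le n$, let $l_1,\dots,l_k\in\mathbb{R}[Z_1,\dots,Z_n]$ be linearly independent linear forms, let $L:\mathbb{R}^n\to\mathbb{R}^k$, $z\mapsto(l_1(z),\dots,l_k(z))$, and let $a\in\mathbb{R}^k$. If $Z_1\in\operatorname{span}(l_1,\dots,l_k)$ and $\mathcal{H}_L(a)\ne\emptyset$, then $\mathcal{H}_L(a)$ has a local extreme point.
   Context: For $z\in\mathbb{R}^n$ let $f_z:=T^n-z_1T^{n-1}+\dots+(-1)^nz_n\in\mathbb{R}[T]$, let $\mathcal{H}:=\{z\in\mathbb{R}^n : f_z \text{ has only real roots}\}$, and let $\mathcal{H}_L(a):=\mathcal{H}\cap L^{-1}(a)$. For $A\subseteq\mathbb{R}^n$, a point $z\in A$ is a local extreme point of $A$ if there is a neighborhood $U\subseteq\mathbb{R}^n$ of $z$ such that $z$ is an extreme point of $\operatorname{conv}(A\cap U)$. *)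

(* Defs.v *)
From HB Require Import structures.
From mathcomp Require Import all_boot all_order all_algebra.
From mathcomp Require Import all_classical all_reals all_analysis.
From mathcomp Require Import complex.

Set Implicit Arguments.
Unset Strict Implicit.
Unset Printing Implicit Defensive.

Import Order.TTheory GRing.Theory Num.Theory.
Import numFieldNormedType.Exports.

Local Open Scope classical_set_scope.
Local Open Scope ring_scope.

(* T^n - z_1 T^(n-1) + ... + (-1)^n z_n; the 0-based entry [z 0 i] is z_(i+1). *)
Definition fpoly (R : realType) (n : nat) (z : 'rV[R]_n) : {poly R} :=
  'X^n + \sum_(i < n) ((-1) ^+ i.+1 * z 0 i) *: 'X^(n - i.+1).

(* [x \is Num.real] for [x : R[i]] means that the imaginary part of x is 0. *)
Definition only_real_roots (R : realType) (p : {poly R}) : Prop :=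
  forall x : R[i], root (map_poly (real_complex R) p) x -> x \is Num.real.

Definition hyperbolic (R : realType) (n : nat) : set 'rV[R]_n :=
  [set z | only_real_roots (fpoly z)].

(* Linear forms in Z_1, ..., Z_n are elements of the dual space of R^n. *)
Notation linform R n := 'Hom('rV[R]_n, R^o).

(* The form Z_(i+1), as an element of the dual space. *)
Definition Zvar (R : realType) (n : nat) (i : 'I_n) : linform R n :=
  linfun (fun z : 'rV[R]_n => z 0 i : R^o).

Lemma ZvarE (R : realType) (n : nat) (i : 'I_n) (z : 'rV[R]_n) :
  Zvar R i z = z 0 i.
Proof.
have lin : linear (fun z : 'rV[R]_n => z 0 i : R^o).
  by move=> a u v; rewrite !mxE.
pose h := GRing.isLinear.Build R 'rV[R]_n R^o *:%R _ lin.
pose f : {linear 'rV[R]_n -> R^o} := HB.pack (fun z : 'rV[R]_n => z 0 i : R^o) h.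
exact: (lfunE f).
Qed.

Definition Lmap (R : realType) (n k : nat) (l : k.-tuple (linform R n))
    (z : 'rV[R]_n) : 'rV[R]_k :=
  \row_(j < k) tnth l j z.

Definition hyperbolic_fiber (R : realType) (n k : nat)
    (l : k.-tuple (linform R n)) (a : 'rV[R]_k) : set 'rV[R]_n :=
  @hyperbolic R n `&` Lmap l @^-1` [set a].

Definition convex_hull (R : realType) (V : lmodType R) (A : set V) : set V :=
  smallest (@convex_set R V) A.

Definition extreme_point (R : realType) (V : lmodType R) (C : set V) (x : V) :
    Prop :=
  C x /\ forall (y w : V) (t : R), C y -> C w -> 0 < t < 1 ->
    x = t *: y + (1 - t) *: w -> y = x /\ w = x.

Definition local_extreme_point (R : realType) (n : nat) (A : set 'rV[R]_n)
    (z : 'rV[R]_n) : Prop :=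
  A z /\ exists2 U : set 'rV[R]_n,
    nbhs z U & extreme_point (convex_hull (A `&` U)) z.

(* Main.v *)
Require Import Defs.
From HB Require Import structures.
From mathcomp Require Import all_boot all_order all_algebra.
From mathcomp Require Import all_classical all_reals all_analysis.
From mathcomp Require Import complex zify ring lra.

(* Parametrise the hyperbolic points by their roots: z = vieta x. On the fiber
   z_1 is constant and |x|^2 = z_1^2 - 2 z_2, so z_2 is bounded above there and
   its maximum is attained on a set which in root coordinates is compact. A
   point of this set of maximal Euclidean norm is an extreme point of the
   convex hull of the whole fiber. *)

Set Implicit Arguments.
Unset Strict Implicit.
Unset Printing Implicit Defensive.

Import Order.TTheory GRing.Theory Num.Theory.
Import numFieldNormedType.Exports.

Local Open Scope classical_set_scope.
Local Open Scope ring_scope.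

(** * Squared Euclidean norm and extreme points of hulls *)

Definition sqnorm (R : realType) (n : nat) (v : 'rV[R]_n) : R :=
  \sum_(i < n) v 0 i ^+ 2.

Lemma sqnorm_ge0 (R : realType) (n : nat) (v : 'rV[R]_n) : 0 <= sqnorm v.
Proof. by apply: sumr_ge0 => i _; exact: sqr_ge0. Qed.

Lemma sqnorm_eq0 (R : realType) (n : nat) (v : 'rV[R]_n) :
  sqnorm v <= 0 -> v = 0.
Proof.
move=> v0; have /eqP : sqnorm v == 0 by rewrite eq_le v0 sqnorm_ge0.
move/(psumr_eq0P (fun i _ => sqr_ge0 (v 0 i))) => h.
by apply/rowP => i; rewrite mxE; apply/eqP; rewrite -sqrf_eq0 h.
Qed.

(** The exact convexity defect of [sqnorm]: the subtracted term is nonnegative for [t] in [0, 1],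
    and for 0 < [t] < 1 it vanishes only if [y = w]. *)
Lemma sqnorm_conv (R : realType) (n : nat) (t : R) (y w : 'rV[R]_n) :
  sqnorm (t *: y + (1 - t) *: w) =
  t * sqnorm y + (1 - t) * sqnorm w - t * (1 - t) * sqnorm (y - w).
Proof.
rewrite /sqnorm !mulr_sumr -big_split -sumrB /=.
by apply: eq_bigr => i _; rewrite !mxE; ring.
Qed.

Lemma continuous_sqnorm (R : realType) (n : nat) :
  continuous (@sqnorm R n).
Proof.
have sqr_coord_continuous i : continuous (fun v : 'rV[R]_n => v 0 i ^+ 2 : R).
  have h : continuous (fun v : 'rV[R]_n => v 0 i : R).
    exact: coord_continuous.
  by move=> v; exact: (cvgM (h v) (h v)).
exact: (@continuous_big R _ +%R 0 xpredT (@add_continuous R^o)).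
Qed.

Lemma compact_sqnorm_le (R : realType) (n : nat) (B : set 'rV[R]_n) (c : R) :
  closed B -> compact (B `&` [set x | sqnorm x <= c]).
Proof.
move=> clB; apply: bounded_closed_compact; last first.
  apply: closedI => //.
  have /continuous_closedP := @continuous_sqnorm R n.
  by move=> /(_ [set y | y <= c]); apply; exact: closed_le.
(* The matrix norm is the sup norm. A point of the set forces [c >= 0], so [M > c + 1] gives
   [c <= M ^+ 2] without a square root. *)
exists (c + 1); split; first exact: num_real.
move=> M cM v [_ /= vc].
have M0 : 0 <= M by have := sqnorm_ge0 v; lra.
rewrite /Num.norm /= mx_normrE; apply/bigmax_leP; split => // -[i j] _ /=.
rewrite (ord1 i).
have : v 0 j ^+ 2 <= sqnorm v.
  by rewrite /sqnorm (bigD1 j) //= lerDl sumr_ge0 // => k _; exact: sqr_ge0.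
by rewrite -[v 0 j ^+ 2]real_normK ?num_real // => hv; nra.
Qed.

(* The set of points lexicographically below [z] for the pair (phi, sqnorm) is
   convex, and [z] is its extreme point because [sqnorm] is strictly convex. *)
Lemma extreme_point_lexmax (R : realType) (n : nat) (phi : 'rV[R]_n -> R)
    (A : set 'rV[R]_n) (z : 'rV[R]_n) :
  (forall t y w, phi (t *: y + (1 - t) *: w) = t * phi y + (1 - t) * phi w) ->
  A z ->
  (forall y, A y -> phi y < phi z \/ phi y = phi z /\ sqnorm y <= sqnorm z) ->
  extreme_point (convex_hull A) z.
Proof.
move=> phi_conv Az zmax.
pose C := [set y | phi y < phi z \/ phi y = phi z /\ sqnorm y <= sqnorm z].
have convC : @convex_set R 'rV[R]_n C.
  move=> x y [t ht] /set_mem Cx /set_mem Cy; apply/mem_set.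
  have [t0 t1] : 0 <= t /\ t <= 1.
    by move: ht; rewrite /Itv.spec /= => /andP[_]; rewrite in_itv /= => /andP[].
  rewrite /C /=.
  have -> : conv (Itv.mk ht) (x : convex_lmodType 'rV[R]_n) y =
      t *: x + (1 - t) *: y by [].
  (* At an endpoint one of the two points has weight zero, so its strict inequality would be lost in
     the mixed cases below. *)
  have [->|tn0] := eqVneq t 0; first by rewrite scale0r add0r subr0 scale1r.
  have [->|tn1] := eqVneq t 1; first by rewrite subrr scale0r addr0 scale1r.
  have tgt0 : 0 < t by rewrite lt_neqAle eq_sym tn0.
  have t'gt0 : 0 < 1 - t by rewrite subr_gt0 lt_neqAle tn1.
  move: (phi_conv t x y) (sqnorm_conv t x y) (sqnorm_ge0 (x - y)).
  move: (phi _) (sqnorm (_ + _)) (sqnorm (_ - _)) => p N D pE NE D0.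
  have tt : 0 <= t * (1 - t) * D by rewrite !mulr_ge0 // ltW.
  by case: Cx Cy => [hx|[hx Nx]] [hy|[hy Ny]];
    [left|left|left|right; split]; nra.
have hullC y : convex_hull A y -> C y by move=> hy; apply: hy.
split; first by move=> D [_ AD]; exact: AD.
move=> y w t /hullC Cy /hullC Cw /andP[t0 t1] zE.
have phiE := phi_conv t y w; rewrite -zE in phiE.
have [phiy phiw] : phi y = phi z /\ phi w = phi z.
  case: Cy Cw => [hy|[hy _]] [hw|[hw _]]; split => //; nra.
have Ny : sqnorm y <= sqnorm z by case: Cy => [|[]//]; rewrite phiy ltxx.
have Nw : sqnorm w <= sqnorm z by case: Cw => [|[]//]; rewrite phiw ltxx.
have NE := sqnorm_conv t y w; rewrite -zE in NE.
(* Both norms are at most [sqnorm z], hence so is their average; [NE] then leaves no room for a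
   positive defect. *)
have /eqP : y - w = 0.
  by apply: sqnorm_eq0; have := mulr_gt0 t0 (_ : 0 < 1 - t); nra.
rewrite subr_eq0 => /eqP yw; rewrite zE yw -scalerDl.
by rewrite addrC subrK scale1r.
Qed.

(** * Coefficients of products of linear factors *)

Lemma continuous_coef_prod_XsubC (R : realType) (T : topologicalType)
    (I : Type) (r : seq I) (F : I -> T -> R) (k : nat) :
  (forall i, continuous (F i)) ->
  continuous (fun x => (\prod_(i <- r) ('X - (F i x)%:P))`_k).
Proof.
move=> cF; elim: r k => [|i r IHr] k x.
  under eq_fun do rewrite big_nil.
  exact: cst_continuous.
under eq_fun do rewrite big_cons mulrBl coefB coefXM coefCM.
apply: cvgB; last by apply: cvgM; [exact: cF|exact: IHr].
by case: k => [|k] /=; [exact: cst_continuous|exact: IHr].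
Qed.

(* Multiplying by ['X^2] makes the second elementary symmetric function a
   coefficient also for sequences of length 0 and 1. *)
Lemma sum_sqr_coef_prod_XsubC (R : realType) (r : seq R) :
  \sum_(x <- r) x ^+ 2 = (\sum_(x <- r) x) ^+ 2
    - ((\prod_(x <- r) ('X - x%:P)) * 'X^2)`_(size r) *+ 2.
Proof.
have top (s : seq R) : (\prod_(x <- s) ('X - x%:P))`_(size s) = 1.
  have /monicP := monic_prod_XsubC s xpredT id.
  by rewrite /lead_coef size_prod_XsubC.
have e1 (s : seq R) :
    ((\prod_(x <- s) ('X - x%:P)) * 'X)`_(size s) = - \sum_(x <- s) x.
  case: s => [|x s]; first by rewrite big_nil mul1r coefX big_nil oppr0.
  by rewrite coefMX /= -coefPn_prod_XsubC.
elim: r => [|x r IHr].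
  by rewrite !big_nil mul1r coefXn expr0n mul0rn subr0.
have coef2 : ((\prod_(y <- r) ('X - y%:P)) * 'X^2)`_(size r).+1 =
    - \sum_(y <- r) y by rewrite expr2 mulrA coefMX e1.
(* A new factor ['X - x%:P] turns e_2 into e_2 + x e_1, which matches the cross term of (x +
   e_1)^2. *)
rewrite !big_cons IHr -mulrA mulrBl coefB coefXM coefCM /= coef2; ring.
Qed.

(** * Passing between roots and coefficients *)

(** The weights add up to 1, so the leading term ['X^n] is preserved. Every coefficient of [fpoly]
    is thus an affine function of the point. *)
Lemma fpoly_conv (R : realType) (n : nat) (t : R) (y w : 'rV[R]_n) :
  fpoly (t *: y + (1 - t) *: w) = t *: fpoly y + (1 - t) *: fpoly w.
Proof.
rewrite /fpoly !scalerDr addrACA -scalerDl.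
rewrite (_ : t + (1 - t) = 1) ?scale1r; last by ring.
congr (_ + _); rewrite !scaler_sumr -big_split /=; apply: eq_bigr => i _.
by rewrite !mxE !scalerA -scalerDl; congr (_ *: _); ring.
Qed.

(** The signs cancel: entry [i] is the elementary symmetric function of degree [i.+1] in the entries
    of [x]. *)
Definition vieta (R : realType) (n : nat) (x : 'rV[R]_n) : 'rV[R]_n :=
  \row_i ((-1) ^+ i.+1 * (\prod_(j < n) ('X - (x 0 j)%:P))`_(n - i.+1)).

Lemma fpoly_vieta (R : realType) (n : nat) (x : 'rV[R]_n) :
  fpoly (vieta x) = \prod_(j < n) ('X - (x 0 j)%:P).
Proof.
set p := \prod_(j < n) _.
have szp : size p = n.+1.
  by rewrite /p size_prod_XsubC /index_enum -enumT size_enum_ord.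
have p1 : p`_n = 1.
  have /monicP := monic_prod_XsubC (index_enum 'I_n) xpredT (fun j => x 0 j).
  by rewrite /lead_coef szp.
rewrite -[RHS]coefK szp poly_def big_ord_recr /= p1 scale1r addrC.
congr (_ + _); rewrite [RHS](reindex_inj rev_ord_inj) /=.
apply: eq_bigr => i _.
by rewrite mxE mulrA -exprD addnn -signr_odd odd_double mul1r.
Qed.

Lemma size_fpoly_tail (R : realType) (n : nat) (z : 'rV[R]_n) :
  (size (\sum_(i < n) ((-1) ^+ i.+1 * z 0%R i) *: 'X^(n - i.+1))%R <= n)%N.
Proof.
apply: (leq_trans (size_sum _ _ _)); apply/bigmax_leqP => i _.
apply: (leq_trans (size_scale_leq _ _)); rewrite size_polyXn.
by have := ltn_ord i; lia.
Qed.

Lemma size_fpoly (R : realType) (n : nat) (z : 'rV[R]_n) :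
  size (fpoly z) = n.+1.
Proof. by rewrite size_polyDl size_polyXn // ltnS size_fpoly_tail. Qed.

Lemma fpoly_monic (R : realType) (n : nat) (z : 'rV[R]_n) :
  fpoly z \is monic.
Proof.
by rewrite monicE lead_coefDl ?lead_coefXn // size_polyXn ltnS size_fpoly_tail.
Qed.

Lemma fpoly_inj (R : realType) (n : nat) : injective (@fpoly R n).
Proof.
move=> y w /addrI E; apply/rowP => i.
have coefE (v : 'rV[R]_n) :
    (\sum_(j < n) ((-1) ^+ j.+1 * v 0 j) *: 'X^(n - j.+1))`_(n - i.+1) =
    (-1) ^+ i.+1 * v 0 i.
  rewrite coef_sum (bigD1 i) //= coefZ coefXn eqxx mulr1 big1 ?addr0 // => j ji.
  rewrite coefZ coefXn; case: eqP => [e|]; last by rewrite mulr0.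
  case/eqP: ji; apply/val_inj => /=; have := ltn_ord i; have := ltn_ord j; lia.
have := congr1 (fun p : {poly R} => p`_(n - i.+1)) E; rewrite !coefE.
by apply: mulfI; rewrite signr_eq0.
Qed.

(** Over [R[i]] the polynomial splits; if all roots are real, the factorization descends to [R]
    because [map_poly] along the embedding is injective. *)
Lemma hyperbolicP (R : realType) (n : nat) (z : 'rV[R]_n) :
  hyperbolic z <-> exists x, z = vieta x.
Proof.
split=> [|[x ->]]; last first.
  move=> u; rewrite fpoly_vieta map_prod_XsubC.
  rewrite -(big_map (fun j => (x 0 j)%:C%C) xpredT (fun c => 'X - c%:P)).
  rewrite root_prod_XsubC => /mapP[j _ ->].
  by apply/complex_realP; exists (x 0 j).
move=> hz.
have [rs] := @closed_field_poly_normal R[i]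
  (map_poly (real_complex R) (fpoly z)).
have /monicP -> : map_poly (real_complex R) (fpoly z) \is monic.
  by rewrite map_monic fpoly_monic.
rewrite scale1r => rsE.
have rs_real : [seq (complex.Re c)%:C%C | c <- rs] = rs.
  apply: map_id_in => c crs; apply: RRe_real; apply: hz.
  by rewrite rsE root_prod_XsubC.
have zE : fpoly z = \prod_(c <- rs) ('X - (complex.Re c)%:P).
  apply: (map_inj_poly (@complexI R)) => //.
  by rewrite rsE map_prod_XsubC -{1}rs_real big_map.
have szrs : size rs = n.
  by apply/eqP; rewrite -eqSS -(size_fpoly z) zE size_prod_XsubC.
exists (\row_j complex.Re (nth 0 rs j)); apply: fpoly_inj.
rewrite fpoly_vieta zE.
rewrite (big_nth 0) szrs big_mkord.
by apply: eq_bigr => j _; rewrite mxE.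
Qed.

Lemma continuous_vieta (R : realType) (n : nat) (i : 'I_n) :
  continuous (fun x : 'rV[R]_n => vieta x 0 i).
Proof.
move=> x; under eq_fun do rewrite mxE.
have h : continuous (fun v : 'rV[R]_n =>
    (\prod_(j < n) ('X - (v 0 j)%:P))`_(n - i.+1)).
  apply: (@continuous_coef_prod_XsubC R 'rV[R]_n _ _ (fun j v => v 0 j)) => j.
  exact: coord_continuous.
exact: (cvgM (cvg_cst ((-1) ^+ i.+1 : R)) (h x)).
Qed.

Lemma continuous_linform_vieta (R : realType) (n : nat) (f : linform R n) :
  continuous (fun x => f (vieta x) : R).
Proof.
move=> x; under eq_fun => v.
  rewrite [vieta v]row_sum_delta linear_sum /=.
  under eq_bigr => i _ do rewrite linearZ /=.
  over.
apply: (@continuous_big R _ +%R 0 xpredT (@add_continuous R^o)) => i _ v.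
exact: (cvgM (@continuous_vieta R n i v) (cvg_cst (f (delta_mx 0 i) : R))).
Qed.

Lemma continuous_sqnorm_vieta (R : realType) (n : nat) :
  continuous (fun x : 'rV[R]_n => sqnorm (vieta x)).
Proof.
apply: (@continuous_big R _ +%R 0 xpredT (@add_continuous R^o)) => i _ v.
exact: (cvgM (@continuous_vieta R n i v) (@continuous_vieta R n i v)).
Qed.

(** Newton's identity p_2 = e_1^2 - 2 e_2 for the roots. Once z_1 is fixed, minimising the norm of
    the roots amounts to maximising z_2. *)
Lemma sqnorm_vieta (R : realType) (n : nat) (x : 'rV[R]_n.+1) :
  sqnorm x =
  vieta x 0 0 ^+ 2 - (fpoly (vieta x) * 'X^2)`_n.+1 *+ 2.
Proof.
pose s := [seq x 0 j | j <- index_enum 'I_n.+1].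
have szs : size s = n.+1 by rewrite size_map /index_enum -enumT size_enum_ord.
have pE : \prod_(j < n.+1) ('X - (x 0 j)%:P) = \prod_(c <- s) ('X - c%:P).
  by rewrite big_map.
have e1 : vieta x 0 0 = \sum_(c <- s) c.
  have := @coefPn_prod_XsubC _ s; rewrite szs => /(_ isT) /= coef_s.
  by rewrite mxE pE subn1 /= coef_s expr1 mulN1r opprK.
rewrite e1 fpoly_vieta pE -{2}szs -sum_sqr_coef_prod_XsubC.
by rewrite /sqnorm big_map.
Qed.

(** * Optimisation on the fiber *)

Lemma fiber_eq_span (R : realType) (n k : nat) (l : k.-tuple (linform R n))
    (a : 'rV[R]_k) (f : linform R n) (y z : 'rV[R]_n) :
  f \in << l >>%VS -> Lmap l y = a -> Lmap l z = a -> f y = f z.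
Proof.
move=> /coord_span -> ya za; rewrite !sum_lfunE; apply: eq_bigr => j _.
rewrite !lfunE /=; congr (_ *: _).
have := congr1 (fun v : 'rV_k => v 0 j) (etrans ya (esym za)).
by rewrite !mxE (tnth_nth 0).
Qed.

Theorem lemma2p21 (R : realType) (n k : nat) (hk : (1 <= k <= n.+1)%N)
    (l : k.-tuple (linform R n.+1)) (hfree : free l) (a : 'rV[R]_k)
    (hZ1 : Zvar R (ord0 : 'I_n.+1) \in << l >>%VS)
    (hne : hyperbolic_fiber l a !=set0) :
  exists z : 'rV[R]_n.+1, local_extreme_point (hyperbolic_fiber l a) z.
Proof.
pose B : set 'rV[R]_n.+1 := [set x | Lmap l (vieta x) = a].
have fiberP z : hyperbolic_fiber l a z <-> exists2 x, B x & z = vieta x.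
  split=> [[/hyperbolicP[x ->] Bx]|[x Bx ->]]; first by exists x.
  by split=> //; apply/hyperbolicP; exists x.
have clB : closed B.
  have -> : B = \bigcap_(j in setT) [set x | tnth l j (vieta x) = a 0 j].
    apply/seteqP; split=> x /=; first by move=> <- j _; rewrite mxE.
    by move=> h; apply/rowP => j; rewrite mxE (h j).
  apply: closed_bigI => j _.
  have /continuous_closedP := @continuous_linform_vieta R n.+1 (tnth l j).
  by move=> /(_ [set y | y = a 0 j]); apply; exact: closed_eq.
have [z0 /fiberP[x0 Bx0 _]] := hne.
(* [B] is only closed; cutting it at the norm of one of its points makes it compact and keeps the
   minimum over all of [B]. *)
have [||| x1 /set_mem[Bx1 x1x0] x1min] :=
  @compact_EVT_min _ R (@sqnorm R n.+1) (B `&` [set x | sqnorm x <= sqnorm x0]).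
- by exists x0; split => /=.
- exact: compact_sqnorm_le.
- exact/continuous_subspaceT/continuous_sqnorm.
have {x1x0} {}x1min x : B x -> sqnorm x1 <= sqnorm x.
  move=> Bx; have [xx0|/ltW x0x] := leP (sqnorm x) (sqnorm x0).
    by apply: x1min; exact/mem_set.
  exact: le_trans x1x0 x0x.
(* By minimality of [x1], this set consists exactly of the minimisers of [sqnorm] on [B]. *)
have [||| x2 /set_mem[Bx2 x2x1] x2max] :=
  @compact_EVT_max _ R (fun x => sqnorm (vieta x))
    (B `&` [set x | sqnorm x <= sqnorm x1]).
- by exists x1; split => /=.
- exact: compact_sqnorm_le.
- exact/continuous_subspaceT/continuous_sqnorm_vieta.
exists (vieta x2); split; first by apply/fiberP; exists x2.
exists setT; first exact: filterT.
rewrite setIT.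
(* [(fpoly z * 'X^2)`_n.+1] is [z_2], and 0 when [n.+1 = 1]. *)
apply: (@extreme_point_lexmax _ _ (fun z => (fpoly z * 'X^2)`_n.+1)).
- move=> t y w /=.
  by rewrite fpoly_conv mulrDl -!scalerAl coefD !coefZ.
- by apply/fiberP; exists x2.
move=> _ /fiberP[x Bx ->].
have := fiber_eq_span hZ1 Bx Bx2; rewrite !ZvarE => z1E.
have := x1min _ Bx; have /= := x2x1; have := x1min _ Bx2.
have := sqnorm_vieta x; have := sqnorm_vieta x2; rewrite z1E => -> -> h1 h2 h3.
(* If the values agree, so do the norms of the roots; then [x] is also a minimiser and [x2max]
   applies. Otherwise the minimality of [sqnorm x2] makes the inequality strict. *)
have [phiE|phiN] := eqVneq ((fpoly (vieta x) * 'X^2)`_n.+1)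
  ((fpoly (vieta x2) * 'X^2)`_n.+1).
  right; split=> //; apply: x2max; apply/mem_set; split=> //=.
  by rewrite [sqnorm x]sqnorm_vieta z1E phiE.
by left; rewrite lt_neqAle phiN; lra.
Qed.
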